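(* Let $(X,\leqslant,\rho)$ be a finite graded poset with minimum and maximum and with a good decomposition $X=A\times B$. Let $f\in[\rho]$ be induced by a function $g\in[\rho_B]$ and let $\iota:B\to B$ be an involution such that $g=\rho_B\circ\iota$. Then the function $\tilde\iota:X\to X$ defined by $$\tilde\iota(a,b):=(a,\iota(b))\quad\text{for all }(a,b)\in A\times B$$ is an involution and $f=\rho\circ\tilde\iota$.
   Context: Let $(X,\leqslant,\rho)$ be a finite graded poset with minimum $\hat 0$, maximum $\hat 1$ and rank function $\rho$ (with $\rho(\hat 0)=0$). $F(X)$ is the ring of functions $X\to\mathbb{Z}$. Functions $f,g\in F(X)$ are equidistributed if $\sum_{x\in X}q^{f(x)}=\sum_{x\in X}q^{g(x)}$ in $\mathbb{N}[q,q^{-1}]$. Write $f\sim g$ if $f,g$ are equidistributed, $f(\hat 0)=g(\hat 0)$ and $f(\hat 1)=g(\hat 1)$; $[f]$ denotes the $\sim$-equivalence class of $f$ (similarly for other finite graded posets with minimum and maximum). An involution is a map $\iota$ with $\iota\circ\iota=\mathrm{id}$. Decompositions: suppose the underlying set of $X$ is (in bijection with) a cartesian product $A\times B$, with projections $\pi_A,\pi_B$. The sets $A$ and $B$ carry the partial orders induced from $\leqslant$ on $X$, for which all inclusions $a\mapsto(a,b)$ ($b\in B$ fixed) and $b\mapsto(a,b)$ ($a\in A$ fixed) are order preserving (so the order on $X$ is a refinement of the product order; $\pi_A,\pi_B$ need not be order preserving), and $\hat 0=(\hat 0_A,\hat 0_B)$, $\hat 1=(\hat 1_A,\hat 1_B)$,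 where $\hat 0_A,\hat 1_A$ (resp. $\hat 0_B,\hat 1_B$) are the minimum and maximum of $A$ (resp. $B$). Put $\rho_A(a)=\rho(a,\hat 0_B)$ and $\rho_B(b)=\rho(\hat 0_A,b)$. The decomposition is good if $(A,\leqslant,\rho_A)$ and $(B,\leqslant,\rho_B)$ are graded posets (with rank functions $\rho_A,\rho_B$) and $\rho=\rho_A\circ\pi_A+\rho_B\circ\pi_B$. For a good decomposition, put $R(f)=f-\rho_A\circ\pi_A$ for $f\in F(X)$. A function $f\in[\rho]$ is induced by $g\in F(B)$ if $g\in[\rho_B]$ and $R(f)=g\circ\pi_B$. *)

(* Defs.v *)
From HB Require Import structures.
From mathcomp Require Import all_boot all_order all_algebra.

Set Implicit Arguments.
Unset Strict Implicit.
Unset Printing Implicit Defensive.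

Import Order.TTheory GRing.Theory Num.Theory.
Local Open Scope ring_scope.

Definition fcomp (S T : finType) (g : {ffun T -> int}) (h : S -> T) :
    {ffun S -> int} :=
  [ffun x => g (h x)].

Section GradedPosets.
Variables (d : Order.disp_t) (X : finTBPOrderType d).

Definition covered_by (x y : X) : Prop :=
  (x < y)%O /\ forall z : X, ~ ((x < z)%O /\ (z < y)%O).

(* Integer-valued so that rank functions are elements of the ring F(X); the
   two conditions force the values to be natural numbers. *)
Definition rank_function (rho : {ffun X -> int}) : Prop :=
  rho \bot%O = 0 /\ forall x y : X, covered_by x y -> rho y = rho x + 1.

(* N[q, q^-1] is viewed inside the field of fractions of Z[q]. *)
Definition gen_fun (f : {ffun X -> int}) : {fraction {poly int}} :=
  \sum_(x : X) tofrac ('X : {poly int}) ^ (f x).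

Definition equidistributed (f g : {ffun X -> int}) : Prop :=
  gen_fun f = gen_fun g.

Definition sim (f g : {ffun X -> int}) : Prop :=
  [/\ equidistributed f g, f \bot%O = g \bot%O & f \top%O = g \top%O].

Definition in_class (f g : {ffun X -> int}) : Prop := sim g f.

End GradedPosets.

(* The order induced on A is the one for which a <= a' means (a, b) <= (a', b)
   for every b, so that all inclusions a |-> (a, b) are order preserving; it
   agrees with the order restricted to a single slice A x {b0} whenever the
   inclusions are order preserving for the latter. Similarly for B. *)
Record decomposition (dX dA dB : Order.disp_t) (X : finTBPOrderType dX)
    (A : finTBPOrderType dA) (B : finTBPOrderType dB) := Decomposition {
  dec_pair : A * B -> X;
  dec_split : X -> A * B;
  dec_pairK : cancel dec_pair dec_split;
  dec_splitK : cancel dec_split dec_pair;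
  dec_leA : forall a a' : A,
    (a <= a')%O <-> forall b : B, (dec_pair (a, b) <= dec_pair (a', b))%O;
  dec_leB : forall b b' : B,
    (b <= b')%O <-> forall a : A, (dec_pair (a, b) <= dec_pair (a, b'))%O;
  dec_bot : dec_pair (\bot%O, \bot%O) = \bot%O;
  dec_top : dec_pair (\top%O, \top%O) = \top%O
}.

Section Decompositions.
Variables (dX dA dB : Order.disp_t) (X : finTBPOrderType dX).
Variables (A : finTBPOrderType dA) (B : finTBPOrderType dB).
Variables (D : decomposition X A B) (rho : {ffun X -> int}).

Definition piA (x : X) : A := (dec_split D x).1.
Definition piB (x : X) : B := (dec_split D x).2.

Definition rhoA : {ffun A -> int} := [ffun a => rho (dec_pair D (a, \bot%O))].
Definition rhoB : {ffun B -> int} := [ffun b => rho (dec_pair D (\bot%O, b))].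

Definition good_decomposition : Prop :=
  [/\ rank_function rhoA, rank_function rhoB
    & rho = fcomp rhoA piA + fcomp rhoB piB].

Definition R_fun (f : {ffun X -> int}) : {ffun X -> int} := f - fcomp rhoA piA.

Definition induced_by (f : {ffun X -> int}) (g : {ffun B -> int}) : Prop :=
  [/\ in_class f rho, in_class g rhoB & R_fun f = fcomp g piB].

Definition iota_tilde (iota : B -> B) (x : X) : X :=
  dec_pair D (piA x, iota (piB x)).

End Decompositions.

(* Main.v *)
Require Import Defs.
From mathcomp Require Import all_boot all_order all_algebra.

Import GRing.Theory.

(** In a good decomposition the rank splits as a sum of a function of the
    [A]-coordinate and a function of the [B]-coordinate, and being induced by
    [g] means that [f] splits in the same way, with the same [A]-part and with
    [g] as [B]-part. Precomposing the rank with [iota_tilde] leaves its [A]-part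
    alone and turns its [B]-part into [rhoB] composed with [iota], which is
    [g]. *)

Section IotaTilde.
Variables (dX dA dB : Order.disp_t) (X : finTBPOrderType dX).
Variables (A : finTBPOrderType dA) (B : finTBPOrderType dB).
Variables (D : decomposition X A B) (iota : B -> B).

Lemma piA_iota_tilde (x : X) : piA D (iota_tilde D iota x) = piA D x.
Proof. by rewrite {1}/piA dec_pairK. Qed.

Lemma piB_iota_tilde (x : X) : piB D (iota_tilde D iota x) = iota (piB D x).
Proof. by rewrite {1}/piB dec_pairK. Qed.

Lemma iota_tilde_involutive :
  involutive iota -> involutive (iota_tilde D iota).
Proof.
move=> iotaK x; rewrite {1}/iota_tilde piA_iota_tilde piB_iota_tilde iotaK.
by rewrite -surjective_pairing dec_splitK.
Qed.

End IotaTilde.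

Theorem theorem3p11 (dX dA dB : Order.disp_t) (X : finTBPOrderType dX)
    (A : finTBPOrderType dA) (B : finTBPOrderType dB)
    (rho : {ffun X -> int}) (D : decomposition X A B)
    (f : {ffun X -> int}) (g : {ffun B -> int}) (iota : B -> B) :
  rank_function rho ->
  good_decomposition D rho ->
  induced_by D rho f g ->
  involutive iota ->
  g = fcomp (rhoB D rho) iota ->
  involutive (iota_tilde D iota) /\ f = fcomp rho (iota_tilde D iota).
Proof.
move=> _ [_ _ rhoE] [_ _ RfE] iotaK gE; split.
  exact: iota_tilde_involutive.
have rhoxE x : rho x = (rhoA D rho (piA D x) + rhoB D rho (piB D x))%R.
  by rewrite {1}rhoE !ffunE.
apply/ffunP => x.
have -> : f x = (g (piB D x) + rhoA D rho (piA D x))%R.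
  by apply/eqP; rewrite -subr_eq; move/ffunP/(_ x): RfE; rewrite !ffunE => ->.
by rewrite gE [RHS]ffunE rhoxE piA_iota_tilde piB_iota_tilde ffunE addrC.
Qed.
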